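(* Call a pair of integers $(\ell_0,m_0)$ admissible if $\ell_0\ge2$, $1\le m_0\le\ell_0$, $\ell_0-m_0$ is even, and the Diophantine equation in the unknowns $(\ell,m)$ $$m_0^2(\ell+2)(\ell-1)\ell=(\ell_0+2)(\ell_0-1)\ell_0\,m^2$$ has only the solution $(\ell,m)=(\ell_0,m_0)$ in the finite set $$T=\{(\ell,m)\in\mathbb{Z}^2:1\le\ell\le c_0,\ 0\le m\le\ell,\ \ell-m\text{ even}\},\qquad c_0=(\ell_0+2)(\ell_0-1)\ell_0m_0^{-2}.$$ Then: (i) For all prime integers $2<p_1<p_2<\dots<p_n$, $n\ge1$, given $\ell_0=p_1p_2\cdots p_n$, the pair $(\ell_0,m_0)=(\ell_0,\ell_0)$ is admissible. (ii) For every prime integer $\ell_0\ge11$, the pair $(\ell_0,m_0)=(\ell_0,\ell_0-2)$ is admissible. (iii) For every prime integer $p>3$, given $\ell_0=2p$, the pair $(\ell_0,m_0)=(\ell_0,\ell_0)$ is admissible. In particular, there are infinitely many admissible pairs $(\ell_0,m_0)$.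
   Context: ''Admissible'' is shorthand for the hypotheses on $(\ell_0,m_0)$ in the paper's bifurcation theorem for rotating traveling waves of a capillary drop; it is fully defined in the claim. *)

(* Defs.v *)
From HB Require Import structures.
From mathcomp Require Import all_boot all_order all_algebra.
From mathcomp Require Import mathcomp_extra boolp classical_sets functions cardinality.
Set Implicit Arguments.
Unset Strict Implicit.
Unset Printing Implicit Defensive.
Import Order.TTheory GRing.Theory Num.Theory.
Local Open Scope ring_scope.
Local Open Scope classical_set_scope.

Definition c0 (l0 m0 : int) : rat :=
  ((l0 + 2) * (l0 - 1) * l0)%:~R / (m0 ^+ 2)%:~R.

Definition T (l0 m0 : int) : set (int * int) :=
  [set lm | let: (l, m) := lm in
    [/\ 1 <= l, l%:~R <= c0 l0 m0, 0 <= m, m <= l & (2 %| l - m)%Z]].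

Definition diophantine (l0 m0 : int) : set (int * int) :=
  [set lm | let: (l, m) := lm in
    m0 ^+ 2 * (l + 2) * (l - 1) * l = (l0 + 2) * (l0 - 1) * l0 * m ^+ 2].

Definition admissible (l0 m0 : int) : Prop :=
  [/\ 2 <= l0, 1 <= m0, m0 <= l0, (2 %| l0 - m0)%Z
    & T l0 m0 `&` diophantine l0 m0 = [set (l0, m0)]].

(* Main.v *)
Require Import Defs.
From mathcomp Require Import all_boot all_order all_algebra.
From mathcomp Require Import mathcomp_extra boolp classical_sets functions cardinality.
From mathcomp Require Import zify ring.
Set Implicit Arguments.
Unset Strict Implicit.
Unset Printing Implicit Defensive.
Import Order.TTheory GRing.Theory Num.Theory.
Local Open Scope ring_scope.
Local Open Scope classical_set_scope.

(** The equation is the equality of m0^2 (l+2)(l-1)l with (l0+2)(l0-1)l0 m^2.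
    The bound l <= c0 keeps l only slightly above l0, and divisibility by the
    prime factors of l0 leaves very few candidates in that range.

    When m0 = l0 = L, the bound reads l < L+1, hence m <= l <= L.  Cancelling L
    leaves L (l+2)(l-1)l = (L+2)(L-1) m^2, and an odd prime factor of L divides
    neither L+2 nor L-1, so it divides m ([diagonal_prime_dvd]).
    - If L is a product of distinct odd primes, L itself divides m, so that
      L <= m <= l <= L ([odd_squarefree_admissible]).
    - If L = 2p, then m is p or 2p.  The second value forces l = 2p.  For
      m = p the equation becomes (l+2)(l-1)l = (p+1)(2p-1)p with p <= l <= 2p;
      as p divides one of l+2, l-1, l, and l is odd like m, only l = p is left,
      where the two sides differ ([twice_prime_admissible]).

    When m0 = L-2 with L an odd prime, L >= 11 gives c0 < 2L-2, and L divides
    (l+2)(l-1)l because it does not divide L-2; hence l is L-2, L+1 or L.  Now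
    L+2 also divides (l+2)(l-1)l, being coprime to L-2.  Modulo L+2 this product
    is -40 for l = L-2 and 2 for l = L+1, which is impossible for L+2 odd and at
    least 13.  For l = L the equation gives m^2 = (L-2)^2
    ([prime_sub2_admissible]).

    Infinitude follows since there are arbitrarily large primes p, each giving
    the admissible pair (2p, 2p). *)

Lemma le_c0E (l0 m0 l : int) : 1 <= m0 ->
  (l%:~R <= c0 l0 m0) = (l * m0 ^+ 2 <= (l0 + 2) * (l0 - 1) * l0).
Proof.
move=> hm; have hm2 : 0 < m0 ^+ 2 by rewrite exprn_gt0 //; lia.
by rewrite /c0 ler_pdivlMr ?ltr0z // -intrM ler_int.
Qed.

(** Uniqueness has to be checked only for l >= 2 and m >= 1: if m = 0, or if
    l = 1, the vanishing of one side of the equation forces (l, m) = (1, 0),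
    which the parity condition excludes. *)
Lemma admissible_intro (l0 m0 : int) :
  2 <= l0 -> 1 <= m0 -> m0 <= l0 -> (2 %| l0 - m0)%Z ->
  (forall l m : int, 2 <= l -> l * m0 ^+ 2 <= (l0 + 2) * (l0 - 1) * l0 ->
     1 <= m -> m <= l -> (2 %| l - m)%Z ->
     m0 ^+ 2 * (l + 2) * (l - 1) * l = (l0 + 2) * (l0 - 1) * l0 * m ^+ 2 ->
     l = l0 /\ m = m0) ->
  admissible l0 m0.
Proof.
move=> hl0 hm0 hle hpar uniq_sol; split=> //; apply/seteqP; split=> [[l m]|].
  move=> [] /= [hl + hm hml hlm] eqn; rewrite le_c0E // => hc.
  have m_neq0 : m <> 0.
    move=> m0E; subst m; have l1 : l = 1 by nia.
    by subst l.
  have l_neq1 : l <> 1.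
    move=> l1; subst l; have : (l0 + 2) * (l0 - 1) * l0 * m ^+ 2 > 0.
      by rewrite !mulr_gt0 ?exprn_gt0 //; lia.
    by rewrite -eqn; lia.
  by have [-> ->] := uniq_sol l m ltac:(lia) hc ltac:(lia) hml hlm eqn.
move=> [l m] [-> ->] /=; split; last by ring.
split=> //; [lia | | lia].
rewrite le_c0E // mulrC; apply: ler_wpM2r; first by lia.
by rewrite expr2; nia.
Qed.

Lemma Euclid_dvdzM (p : nat) (a b : int) : prime p ->
  (p %| a * b)%Z = (p %| a)%Z || (p %| b)%Z.
Proof. by move=> pp; rewrite !dvdzE abszM Euclid_dvdM. Qed.

(** Used to list the possible quotients of a bounded multiple of d: the bounds
    on k * d are linear, whereas those on k are not. *)
Lemma multiplier_between (a b d k : int) :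
  0 < d -> a * d < k * d -> k * d < b * d -> a < k < b.
Proof. by move=> d_gt0; rewrite !ltr_pM2r // => -> ->. Qed.

(** Modulo p, the factors L + 2 and L - 1 are 2 and -1, which are units because
    p is odd; so p divides m ^ 2. *)
Lemma diagonal_prime_dvd (p : nat) (L l m : int) :
  prime p -> (2 < p)%N -> (p %| L)%Z -> 0 < L ->
  L ^+ 2 * (l + 2) * (l - 1) * l = (L + 2) * (L - 1) * L * m ^+ 2 ->
  (p %| m)%Z.
Proof.
move=> pp p_gt2 pL L_gt0 eqn.
have eqn' : L * ((l + 2) * (l - 1) * l) = (L + 2) * (L - 1) * m ^+ 2.
  by apply: (mulfI (x := L)); lia.
have : (p %| (L + 2) * (L - 1) * (m * m))%Z.
  by rewrite -expr2 -eqn' dvdz_mulr.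
rewrite !Euclid_dvdzM // orbb !(rpredDl _ pL) !dvdzE /=.
by rewrite 2?gtnNdvd // ltnW.
Qed.

(** Here c0 = L + 1 - 2 / L. *)
Lemma diagonal_bound (L l : int) : 2 <= L ->
  l * L ^+ 2 <= (L + 2) * (L - 1) * L -> l <= L.
Proof.
move=> hL; rewrite expr2 mulrA => hl.
have {}hl : l * L <= (L + 2) * (L - 1) by rewrite -(ler_pM2r (x := L)) //; lia.
by nia.
Qed.

Lemma distinct_primes_dvd (n : nat) (p : 'I_n -> nat) (m : nat) :
  (forall i, prime (p i)) -> injective p -> (forall i, p i %| m)%N ->
  (\prod_(i < n) p i %| m)%N.
Proof.
move=> pp p_inj pm; apply/unstable.Gauss_dvd_prod => [|i _ _]; last exact: pm.
rewrite pairwise_map filter_predT.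
apply: (@sub_pairwise _ (fun i j => i != j)); last first.
  by rewrite -uniq_pairwise index_enum_uniq.
move=> i j ij /=; rewrite prime_coprime // dvdn_prime2 //.
by apply: contra ij => /eqP /p_inj ->.
Qed.

Lemma odd_squarefree_admissible (n : nat) (p : 'I_n -> nat) :
  (1 <= n)%N -> (forall i, prime (p i)) -> (forall i, 2 < p i)%N ->
  injective p ->
  admissible (\prod_(i < n) p i)%N%:Z (\prod_(i < n) p i)%N%:Z.
Proof.
move=> n_gt0 pp p_gt2 p_inj; set L := (\prod_(i < n) p i)%N.
have pL i : (p i %| L)%N by rewrite /L (bigD1 i) //= dvdn_mulr.
have L_gt0 : (0 < L)%N by rewrite /L prodn_gt0 // => i; apply: prime_gt0.
have L_gt2 : (2 < L)%N.
  by apply: leq_trans (p_gt2 (Ordinal n_gt0)) _; apply: dvdn_leq.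
have L_ge2 : 2 <= L%:Z by lia.
apply: admissible_intro; rewrite ?subrr ?dvdz0 //; try lia.
move=> l m hl /(diagonal_bound L_ge2) lL hm ml _ eqn.
have Lm : (L %| `|m|)%N.
  apply: distinct_primes_dvd => // i.
  have piL : (p i %| L%:Z)%Z by rewrite dvdzE; exact: pL.
  by have := diagonal_prime_dvd (pp i) (p_gt2 i) piL L_gt0 eqn; rewrite dvdzE.
have m_gt0 : (0 < `|m|)%N by lia.
by have := dvdn_leq m_gt0 Lm; lia.
Qed.

Lemma twice_prime_admissible (p : nat) : prime p -> (3 < p)%N ->
  admissible (2 * p)%N%:Z (2 * p)%N%:Z.
Proof.
move=> pp p_gt3; have p_odd : odd p by case: (even_prime pp) => // p2; lia.
have L_ge2 : 2 <= (2 * p)%N%:Z by lia.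
apply: admissible_intro; rewrite ?subrr ?dvdz0 //; try lia.
move=> l m hl /(diagonal_bound L_ge2) lL hm ml lm_even eqn.
have /dvdzP[k mE] : (p %| m)%Z.
  apply: (diagonal_prime_dvd pp _ _ _ eqn); [lia | | lia].
  by rewrite PoszM dvdz_mull.
have p_gt0 : 0 < p%:Z by lia.
have [k1|k2] : k = 1 \/ k = 2.
  by have := @multiplier_between 0 3 p k p_gt0 ltac:(lia) ltac:(lia); lia.
  exfalso; subst k; rewrite mul1r in mE; subst m.
  (* m = p: the common factor 4 p ^ 2 cancels. *)
  have eqn' : (l + 2) * (l - 1) * l = (p%:Z + 1) * (2 * p%:Z - 1) * p%:Z.
    apply: (mulfI (x := 4 * p%:Z ^+ 2)); first by lia.
    by move: eqn; rewrite PoszM; lia.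
  have : (p %| (l + 2) * (l - 1) * l)%Z by rewrite eqn' dvdz_mull.
  rewrite !Euclid_dvdzM // => /orP[/orP[]|] /dvdzP[k kE].
  (* Since p <= l <= 2p and l is odd, l + 2 = k p would need k = 2, against
     parity; l - 1 = k p would need k = 1, again against parity; and l = k p
     needs k = 1. *)
  - by have := @multiplier_between 1 3 p k p_gt0 ltac:(lia) ltac:(lia); lia.
  - by have := @multiplier_between 0 2 p k p_gt0 ltac:(lia) ltac:(lia); lia.
  - have k1 : k = 1.
      by have := @multiplier_between 0 3 p k p_gt0 ltac:(lia) ltac:(lia); lia.
    by move: eqn'; rewrite kE k1; nia.
by lia.
Qed.

Lemma prime_sub2_admissible (L : nat) : prime L -> (11 <= L)%N ->
  admissible L%:Z (L%:Z - 2).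
Proof.
move=> pL L_ge11; have L_odd : odd L by case: (even_prime pL) => // p2; lia.
have cop2 : coprimez (L%:Z + 2) ((L%:Z - 2) ^+ 2).
  apply: coprimezXr; rewrite coprimezE.
  have -> : (`|(L%:Z + 2)%R| = 4 + `|(L%:Z - 2)%R|)%N by lia.
  rewrite coprime_sym /coprime gcdnDr -/(coprime _ (2 ^ 2)) coprimeXr //.
  by rewrite coprimen2; lia.
apply: admissible_intro; try lia.
move=> l m hl hc hm ml lm_even eqn.
(* This is where L >= 11 is used: c0 < 2L - 2 means L ^ 2 - 10 L + 8 > 0. *)
have l_lt : l < 2 * L%:Z - 2.
  have : l * (L%:Z - 2) ^+ 2 < (2 * L%:Z - 2) * (L%:Z - 2) ^+ 2.
    apply: le_lt_trans hc _; rewrite expr2; nia.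
  by rewrite ltr_pM2r // exprn_gt0 //; lia.
have L2dvd : (L%:Z + 2 %| (l + 2) * (l - 1) * l)%Z.
  rewrite -(Gauss_dvdzr _ cop2) !mulrA eqn -!mulrA.
  exact: dvdz_mulr.
have : (L %| (L%:Z - 2) * (L%:Z - 2) * (l + 2) * (l - 1) * l)%Z.
  by rewrite -expr2 eqn -mulrA dvdz_mull // dvdz_mulr.
have LN2 : ~~ (L %| L%:Z - 2)%Z.
  by rewrite rpredDl // dvdzE gtnNdvd //; lia.
have L_gt0 : 0 < L%:Z by lia.
rewrite !Euclid_dvdzM // (negPf LN2) /= => /orP[/orP[]|] /dvdzP[k kE].
- have k1 : k = 1.
    by have := @multiplier_between 0 2 L k L_gt0 ltac:(lia) ltac:(lia); lia.
  have lE : l = L%:Z - 2 by lia.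
  case/dvdzP: L2dvd => q; rewrite lE => qE.
  (* (l+2)(l-1)l = L(L-3)(L-2) = (L ^ 2 - 7 L + 20)(L + 2) - 40, so L + 2 would
     be an odd divisor of 40 that is at least 13. *)
  set r := L%:Z ^+ 2 - 7 * L%:Z + 20 - q.
  have rE : 40 = r * (L%:Z + 2).
    have -> : r * (L%:Z + 2) =
        (L%:Z ^+ 2 - 7 * L%:Z + 20) * (L%:Z + 2) - q * (L%:Z + 2).
      by rewrite /r; ring.
    by rewrite -qE; ring.
  have r123 : r = 1 \/ r = 2 \/ r = 3.
    have := @multiplier_between 0 4 (L%:Z + 2) r
      ltac:(lia) ltac:(lia) ltac:(lia).
    by lia.
  by case: r123 => [|[|]] rk; lia.
- have k1 : k = 1.
    by have := @multiplier_between 0 2 L k L_gt0 ltac:(lia) ltac:(lia); lia.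
  have lE : l = L%:Z + 1 by lia.
  case/dvdzP: L2dvd => q; rewrite lE => qE.
  (* (l+2)(l-1)l = (L+3)L(L+1) = (L ^ 2 + 2 L - 1)(L + 2) + 2, so L + 2 would
     divide 2. *)
  set r := q - (L%:Z ^+ 2 + 2 * L%:Z - 1).
  have rE : 2 = r * (L%:Z + 2).
    have -> : r * (L%:Z + 2) =
        q * (L%:Z + 2) - (L%:Z ^+ 2 + 2 * L%:Z - 1) * (L%:Z + 2).
      by rewrite /r; ring.
    by rewrite -qE; ring.
  have := @multiplier_between 0 1 (L%:Z + 2) r
    ltac:(lia) ltac:(lia) ltac:(lia).
  by lia.
- have k1 : k = 1.
    by have := @multiplier_between 0 2 L k L_gt0 ltac:(lia) ltac:(lia); lia.
  have lE : l = L%:Z by lia.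
  split; first by rewrite lE.
  have /eqP : m ^+ 2 = (L%:Z - 2) ^+ 2.
    apply: (mulfI (x := (L%:Z + 2) * (L%:Z - 1) * L%:Z)); first by lia.
    by rewrite -eqn lE; ring.
  rewrite eqf_sqr => /orP[] /eqP; lia.
Qed.

Theorem proposition6p15 :
  [/\ forall (n : nat) (p : 'I_n -> nat),
        (1 <= n)%N ->
        (forall i, prime (p i)) ->
        (forall i, 2 < p i)%N ->
        (forall i j : 'I_n, i < j -> p i < p j)%N ->
        let l0 := (\prod_(i < n) p i)%N in
        admissible l0%:Z l0%:Z,
      forall l0 : nat, prime l0 -> (11 <= l0)%N ->
        admissible l0%:Z (l0%:Z - 2),
      forall p : nat, prime p -> (3 < p)%N ->
        let l0 := (2 * p)%N in
        admissible l0%:Z l0%:Z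
    & infinite_set [set lm : int * int | admissible lm.1 lm.2]].
Proof.
split.
- move=> n p n_gt0 pp p_gt2 p_incr /=; apply: odd_squarefree_admissible => //.
  move=> i j pij; apply: val_inj => /=.
  by case: (ltngtP i j) => // /p_incr; rewrite pij ltnn.
- exact: prime_sub2_admissible.
- exact: twice_prime_admissible.
move=> /finite_seqP[s sE].
set M := (\max_(lm <- s) `|lm.1|)%N.
have [q q_gt pq] := prime_above (M + 3).
have : [set lm : int * int | admissible lm.1 lm.2] ((2 * q)%N%:Z, (2 * q)%N%:Z).
  by apply: twice_prime_admissible => //; lia.
rewrite sE /= => qs.
have : (`|(2 * q)%:Z| <= M)%N.
  exact: (@leq_bigmax_seq _ s predT (fun lm : int * int => `|lm.1|%N) _ qs isT).
by lia.
Qed.
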